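(* Let $f,g:\mathbb{R}^n\to(-\infty,+\infty]$ be proper, lower semicontinuous and level-coercive, let $\mu>0$, and for $\alpha\in[0,1]$ let $\varphi^{\alpha}_{\mu}=-e_{\mu}(-\alpha e_{\mu}f-(1-\alpha)e_{\mu}g)$. Then for every $\bar\alpha\in[0,1]$, $$\lim_{\alpha\to\bar\alpha}\inf\varphi^{\alpha}_{\mu}=\inf\varphi^{\bar\alpha}_{\mu}\ \text{(finite)},\qquad \limsup_{\alpha\to\bar\alpha}\operatorname{argmin}\varphi^{\alpha}_{\mu}\subseteq\operatorname{argmin}\varphi^{\bar\alpha}_{\mu}.$$ Moreover, $(\operatorname{argmin}\varphi^{\alpha}_{\mu})_{\alpha\in[0,1]}$ lies in a bounded set. Consequently, $$\lim_{\alpha\downarrow0}\inf\varphi^{\alpha}_{\mu}=\inf g,\quad \limsup_{\alpha\downarrow0}\operatorname{argmin}\varphi^{\alpha}_{\mu}\subseteq\operatorname{argmin}g;\qquad \lim_{\alpha\uparrow1}\inf\varphi^{\alpha}_{\mu}=\inf f,\quad \limsup_{\alpha\uparrow1}\operatorname{argmin}\varphi^{\alpha}_{\mu}\subseteq\operatorname{argmin}f.$$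
   Context: $\|\cdot\|$ is the Euclidean norm; $\inf$ and $\operatorname{argmin}$ are over $\mathbb{R}^n$. $f$ is level-coercive if $\liminf_{\|x\|\to\infty}f(x)/\|x\|>0$. For a proper function $f$ and $\mu>0$, $e_{\mu}f(x)=\inf_{w}\{f(w)+\frac{1}{2\mu}\|w-x\|^2\}$. (Level-coercive proper lsc functions are bounded below, so every $\mu>0$ is admissible.) $\limsup_{\alpha\to\bar\alpha}S_\alpha$ is the Painlevé--Kuratowski outer limit: the set of all limits of sequences $x_k\in S_{\alpha_k}$ along subsequences of sequences $\alpha_k\to\bar\alpha$ (i.e., all cluster points of such sequences). *)

(* Defs.v *)
From HB Require Import structures.
From mathcomp Require Import all_boot all_order all_algebra.
From mathcomp Require Import all_classical all_reals all_analysis.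

Set Implicit Arguments.
Unset Strict Implicit.
Unset Printing Implicit Defensive.

Import Order.TTheory GRing.Theory Num.Theory.
Import numFieldNormedType.Exports.

Local Open Scope classical_set_scope.
Local Open Scope ring_scope.

(* The library norm on 'rV[R]_n is the maximum norm, hence this definition;
   the two norms induce the same topology, so the library's notions of
   convergence and lower semicontinuity on 'rV[R]_n are the usual ones. *)
Definition enorm (R : realType) (n : nat) (x : 'rV[R]_n) : R :=
  Num.sqrt (\sum_(i < n) x ord0 i ^+ 2).

Definition enorm_pinfty (R : realType) (n : nat) : set_system 'rV[R]_n :=
  filter_from [set: R] (fun M => [set x : 'rV[R]_n | M < enorm x]).

Local Open Scope ereal_scope.

Definition proper_efun (T : Type) (R : realType) (f : T -> \bar R) : Prop :=
  (forall x, -oo < f x) /\ (exists x, f x < +oo).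

(* The (irrelevant) value of the quotient at x = 0 is the library default. *)
Definition level_coercive (R : realType) (n : nat) (f : 'rV[R]_n -> \bar R) :
    Prop :=
  0 < limf_einf (fun x => f x / (enorm x)%:E) (@enorm_pinfty R n).

Definition einf (T : Type) (R : realType) (f : T -> \bar R) : \bar R :=
  ereal_inf (range f).

Definition argmin (T : Type) (R : realType) (f : T -> \bar R) : set T :=
  [set x | f x = einf f].

Definition moreau_env (R : realType) (n : nat) (mu : R)
    (f : 'rV[R]_n -> \bar R) (x : 'rV[R]_n) : \bar R :=
  einf (fun w => f w + (1 / (2 * mu) * enorm (w - x)%R ^+ 2)%:E).

(* For mu > 0 and f, g proper and bounded below, the envelopes of f and g are
   finite everywhere, so no indeterminate form occurs. *)
Definition proximal_avg (R : realType) (n : nat) (mu : R)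
    (f g : 'rV[R]_n -> \bar R) (alpha : R) (x : 'rV[R]_n) : \bar R :=
  - moreau_env mu
      (fun y => - alpha%:E * moreau_env mu f y
                - (1 - alpha)%:E * moreau_env mu g y) x.

(* Painleve--Kuratowski outer limit of S alpha as alpha tends to abar within D:
   limits of points x k of S (alpha_(N k)) along subsequences alpha \o N of
   sequences alpha of D converging to abar. *)
Definition outer_limit (R : realType) (V : topologicalType) (D : set R)
    (abar : R) (S : R -> set V) : set V :=
  [set xbar | exists (alpha : nat -> R) (N : nat -> nat) (x : nat -> V),
    [/\ forall k, D (alpha k),
        alpha @ \oo --> abar,
        increasing_seq N,
        forall k, S (alpha (N k)) (x k) &
        x @ \oo --> xbar]].

(* Main.v *)
Require Import Defs.
From HB Require Import structures.
From mathcomp Require Import all_boot all_order all_algebra.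
From mathcomp Require Import all_classical all_reals all_analysis.
From mathcomp Require Import ring lra.

Set Implicit Arguments.
Unset Strict Implicit.
Unset Printing Implicit Defensive.

Import Order.TTheory GRing.Theory Num.Theory.
Import numFieldNormedType.Exports.

Local Open Scope classical_set_scope.
Local Open Scope ring_scope.

(* Put F = e_mu f, G = e_mu g, q = 1 / (2 mu) and
   psi_alpha = alpha F + (1 - alpha) G.  Then psi_alpha <= phi^alpha, while
   psi_alpha - q |.|^2 is concave; hence at a minimizer x of psi_alpha one has
   psi_alpha y <= psi_alpha x + q |y - x|^2 for every y, which says
   phi^alpha x <= psi_alpha x.  So phi^alpha and psi_alpha have the same infimum
   and the same minimizers.  The psi_alpha are coercive uniformly in alpha, and
   on the ball containing all their minimizers they are Lipschitz in alpha,
   which gives the limits.  At the end points, e_mu g has the same infimum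
   as g, and its minimizers minimize g because g is lower semicontinuous. *)

(** * Minimization of lower semicontinuous functions on compact sets *)

Lemma real_between_ereal (R : realType) (x y : \bar R) :
  (x < y)%E -> exists c : R, (x < c%:E < y)%E.
Proof.
case: x y => [x| |] [y| |] //; rewrite ?ltry ?ltNyr ?lte_fin => xy.
- by exists ((x + y) / 2); rewrite !lte_fin midf_lt // midf_lt.
- by exists (x + 1); rewrite lte_fin ltry ltrDl ltr01.
- by exists (y - 1); rewrite ltNyr lte_fin ltrBlDr ltrDl ltr01.
- by exists 0; rewrite ltNyr ltry.
Qed.

(** If no minimum is attained, [f] exceeds its infimum [m] at each point of [K], hence exceeds some
    real level above [m] near that point; compactness makes the level uniform, which contradicts the
    choice of [m]. *)
Lemma lower_semicontinuous_compact_min (T : topologicalType) (R : realType)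
    (f : T -> \bar R) (K : set T) :
  compact K -> K !=set0 -> lower_semicontinuous f ->
  exists2 x, K x & forall y, K y -> (f x <= f y)%E.
Proof.
move=> /compact_near_coveringP Kc [x0 Kx0] f_lsc.
apply: contrapT => nomin; pose m := ereal_inf (f @` K).
have m_lt x : K x -> (m < f x)%E.
  move=> Kx; rewrite ltNge; apply/negP => fxm; apply: nomin.
  exists x => // y Ky.
  by apply: (le_trans fxm); apply: ereal_inf_lbound; exists y.
(* This filter encodes real levels decreasing to [m], so that the near-covering form of compactness
   yields one level for all of [K]. *)
pose F := filter_from [set c : R | (m < c%:E)%E] (fun c => [set d | d <= c]).
have FF : Filter F.
  apply: filter_from_filter.
    by have [c /andP[mc _]] := real_between_ereal (m_lt _ Kx0); exists c.
  move=> c d mc md; exists (Num.min c d).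
    by rewrite /= /Num.min; case: ifP.
  by move=> e /=; rewrite le_min => /andP[].
have [|c mc /(_ c (lexx c))/= fc] := Kc R F (fun c x => (c%:E < f x)%E) FF.
  move=> x /m_lt/real_between_ereal[c /andP[mc /f_lsc[V Vx fV]]].
  exists (V, [set d | d <= c]); first by split => //; exists c.
  by move=> [y d] /= [/fV cy dc]; rewrite (le_lt_trans _ cy)// lee_fin.
suff : (c%:E <= m)%E by rewrite leNgt mc.
by apply: le_ereal_inf_tmp => _ [x Kx <-]; exact/ltW/fc.
Qed.

(** * Euclidean versus maximum norm, and quadratic identities *)

Section squared_norm.
Context {R : realType} {n : nat}.
Implicit Types x y z w d : 'rV[R]_n.

Definition sqnorm x : R := \sum_(i < n) x ord0 i ^+ 2.

Lemma sqnorm_ge0 x : 0 <= sqnorm x.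
Proof. by apply: sumr_ge0 => i _; exact: sqr_ge0. Qed.

Lemma sqnorm0 : sqnorm 0 = 0.
Proof. by rewrite /sqnorm big1// => i _; rewrite mxE expr0n. Qed.

Lemma enorm_sqr x : enorm x ^+ 2 = sqnorm x.
Proof. exact/sqr_sqrtr/sqnorm_ge0. Qed.

Lemma coord_le_mx_norm x i : `|x ord0 i| <= `|x|.
Proof.
rewrite [leRHS]mx_normrE.
exact: (le_bigmax _ (fun ij : 'I_1 * 'I_n => `|x ij.1 ij.2|) (ord0, i)).
Qed.

Lemma mx_norm_le_enorm x : `|x| <= enorm x.
Proof.
have [->|x0] := eqVneq `|x| 0; first exact: sqrtr_ge0.
have /mx_norm_neq0[[i j] /= xij] : mx_norm x != 0 by [].
rewrite [leLHS]xij -sqrtr_sqr ler_sqrt ?sqnorm_ge0// (ord1 i).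
rewrite (bigD1 j)//= lerDl.
by apply: sumr_ge0 => k _; exact: sqr_ge0.
Qed.

Lemma sqr_mx_norm_le x : `|x| ^+ 2 <= sqnorm x.
Proof.
by rewrite -enorm_sqr lerXn2r ?nnegrE ?normr_ge0 ?sqrtr_ge0// mx_norm_le_enorm.
Qed.

Lemma sqnorm_le x : sqnorm x <= n%:R * `|x| ^+ 2.
Proof.
have -> : n%:R * `|x| ^+ 2 = \sum_(i < n) `|x| ^+ 2.
  by rewrite sumr_const card_ord mulr_natl.
apply: ler_sum => i _.
by rewrite -real_normK ?num_real// lerXn2r ?nnegrE// coord_le_mx_norm.
Qed.

Lemma enorm_le x : enorm x <= Num.sqrt (n%:R * `|x| ^+ 2).
Proof. by rewrite ler_sqrt ?sqnorm_le// mulr_ge0// sqr_ge0. Qed.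

Lemma sqnorm_near x (e : R) : 0 < e -> \forall y \near x, sqnorm (y - x) < e.
Proof.
(* Using [n.+1] keeps the denominator nonzero when [n] is 0 and leaves a spare [|y - x| ^+ 2], which
   makes the bound strict when [y != x]. *)
move=> e0; pose r := Num.sqrt (e / n.+1%:R).
have r0 : 0 < r by rewrite sqrtr_gt0 divr_gt0.
near=> y.
have yx : `|y - x| < r.
  have : ball x r y by near: y; exact: nbhsx_ballx.
  by rewrite -ball_normE/= distrC.
apply: le_lt_trans (sqnorm_le _) _.
have : `|y - x| ^+ 2 <= e / n.+1%:R.
  rewrite -(@sqr_sqrtr _ (e / n.+1%:R)); last exact/ltW/divr_gt0.
  by rewrite lerXn2r ?nnegrE// ltW.
rewrite ler_pdivlMr ?ltr0n// -natr1 mulrDr mulr1 mulrC => h.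
have [->|yx0] := eqVneq (y - x) 0; first by rewrite normr0 expr0n/= mulr0.
by apply: lt_le_trans h; rewrite ltrDl exprn_gt0// normr_gt0.
Unshelve. all: end_near. Qed.

(* The coordinatewise identity
   t (u - d)^2 + (u + t d)^2 = (1 + t) (u^2 + t d^2) with u = w - x. *)
Lemma sqnorm_stewart w x d (t : R) :
  t * sqnorm (w - (x + d)) + sqnorm (w - (x - t *: d)) =
  (1 + t) * (sqnorm (w - x) + t * sqnorm d).
Proof.
rewrite /sqnorm !mulr_sumr -!big_split/= mulr_sumr; apply: eq_bigr => i _.
by rewrite !mxE; ring.
Qed.

(** Young's inequality for [w - y = (w - x) + (x - y)]: after multiplication by [s], the difference
    of the sides is coordinatewise a sum of nonnegative terms. It compares the quadratic penalties
    at two base points. *)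
Lemma sqnorm_young w x y (s : R) : 0 < s ->
  (1 - s) * sqnorm (w - y) <= sqnorm (w - x) + s^-1 * sqnorm (x - y).
Proof.
move=> s0; rewrite /sqnorm !mulr_sumr -big_split/=; apply: ler_sum => i _.
rewrite !mxE; set u := w _ _; set v := x _ _; set z := y _ _.
rewrite -(ler_pM2l s0) [leRHS]mulrDr mulVKf ?gt_eqF// -subr_ge0.
rewrite (_ : _ - _ = (s * (u - v) - (1 - s) * (v - z)) ^+ 2
                     + s * (v - z) ^+ 2); last by ring.
by rewrite addr_ge0 ?sqr_ge0// mulr_ge0 ?sqr_ge0 ?ltW.
Qed.

Lemma compact_mx_ball (M : R) : compact [set x : 'rV[R]_n | `|x| <= M].
Proof.
rewrite (_ : mkset _ = closed_ball_ (fun v : 'rV[R]_n => `|v|) 0 M).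
  apply: bounded_closed_compact; last exact: closed_closed_ball_.
  exists M; split; first exact: num_real.
  move=> e Me x; rewrite /closed_ball_/= sub0r normrN => xM.
  exact: le_trans xM (ltW Me).
by apply/seteqP; split=> x; rewrite /closed_ball_/= sub0r normrN.
Qed.

End squared_norm.

(** * Bounds, semicontinuity and minimizers of envelope-like functions *)

Section envelope_like.
Context {R : realType} {n : nat}.
Implicit Types (F G : 'rV[R]_n -> R) (x y z w d : 'rV[R]_n).

(* The inequalities shared by the Moreau envelopes of all functions minorized
   by [a * `|x| - b], with [q = 1 / (2 * mu)].  All three are preserved by
   convex combinations; the last one says that [F - q * |x|^2] is concave. *)
Record envelope_like (q a b : R) F : Prop := EnvelopeLike {
  envelope_like_coercive : forall x, a * `|x| - b <= F x;
  envelope_like_lower : forall s x y, 0 < s <= 1 ->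
    (1 - s) * F y - s * b - q * s^-1 * sqnorm (x - y) <= F x;
  envelope_like_semiconcave : forall x d t, 0 <= t ->
    t * F (x + d) + F (x - t *: d) <= (1 + t) * (F x + q * t * sqnorm d) }.

Variables (q a b : R).
Hypotheses (q_gt0 : 0 < q) (a_gt0 : 0 < a).

Lemma envelope_like_conv F G (alpha : R) : 0 <= alpha <= 1 ->
  envelope_like q a b F -> envelope_like q a b G ->
  envelope_like q a b (fun x => alpha * F x + (1 - alpha) * G x).
Proof.
move=> /andP[al0 al1] [Fc Fl Fs] [Gc Gl Gs]; split.
- move=> x; rewrite [leLHS](_ : _ = alpha * (a * `|x| - b)
    + (1 - alpha) * (a * `|x| - b)); last by ring.
  by rewrite lerD// ler_wpM2l ?subr_ge0.
- move=> s x y s01; set e := q * _ * _; rewrite [leLHS](_ : _ =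
    alpha * ((1 - s) * F y - s * b - e)
    + (1 - alpha) * ((1 - s) * G y - s * b - e)); last by ring.
  by apply: lerD; apply: ler_wpM2l; rewrite ?subr_ge0//; [exact: Fl|exact: Gl].
- move=> x d t t0; rewrite [leLHS](_ : _ =
    alpha * (t * F (x + d) + F (x - t *: d))
    + (1 - alpha) * (t * G (x + d) + G (x - t *: d))); last by ring.
  rewrite [leRHS](_ : _ = alpha * ((1 + t) * (F x + q * t * sqnorm d))
    + (1 - alpha) * ((1 + t) * (G x + q * t * sqnorm d))); last by ring.
  by apply: lerD; apply: ler_wpM2l; rewrite ?subr_ge0//; [exact: Fs|exact: Gs].
Qed.

Variable F : 'rV[R]_n -> R.
Hypothesis F_env : envelope_like q a b F.

Lemma envelope_like_lbound x : - b <= F x.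
Proof.
apply: le_trans (envelope_like_coercive F_env x).
by rewrite lerDr mulr_ge0// ltW.
Qed.

(** Semiconcavity at 0 in the directions [x] and [- x], the value at [- x] being at least [- b]. *)
Lemma envelope_like_ubound x : F x <= 2 * F 0 + 2 * (q * sqnorm x) + b.
Proof.
have := envelope_like_semiconcave F_env 0 x ler01.
rewrite add0r scale1r sub0r mulr1; have := envelope_like_lbound (- x).
by lra.
Qed.

Lemma envelope_like_lsc : lower_semicontinuous (EFin \o F).
Proof.
move=> x c /=; rewrite lte_fin => cF.
have Fb : 0 <= F x + b by have := envelope_like_lbound x; lra.
pose D := F x - c; have D0 : 0 < D by rewrite subr_gt0.
(* With this [s] the loss [s * (F x + b)] in [envelope_like_lower] is at most [D / 2]; closeness of
   [y] to [x] then keeps the quadratic loss below [D / 4], so [F y] stays above [c]. *)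
pose s := D / (2 * (F x + b + D)).
have E0 : 0 < 2 * (F x + b + D) by lra.
have s0 : 0 < s by rewrite divr_gt0.
have sE : s * (2 * (F x + b + D)) = D by rewrite mulfVK// gt_eqF.
have s1 : s <= 1 by rewrite ler_pdivrMr// mul1r; lra.
have sFb : s * (F x + b) <= D / 2 by nra.
have e0 : 0 < s * (D / 4) / q by rewrite divr_gt0// mulr_gt0// divr_gt0.
exists [set y | sqnorm (y - x) < s * (D / 4) / q]; first exact: sqnorm_near.
move=> y /=; rewrite ltr_pdivlMr// lte_fin => yx.
have s01 : 0 < s <= 1 by rewrite s0.
have := envelope_like_lower F_env y x s01.
have : q * s^-1 * sqnorm (y - x) < D / 4.
  by rewrite mulrAC ltr_pdivrMr// mulrC [ltRHS]mulrC.
rewrite /D in D0 sFb *; lra.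
Qed.

Lemma envelope_like_has_min : exists x, forall y, F x <= F y.
Proof.
(* Outside the ball of radius [M], coercivity forces values above [F 0], so a minimizer over the
   ball is global. *)
pose M := (F 0 + b) / a.
have M0 : 0 <= M.
  by rewrite divr_ge0 ?(ltW a_gt0)//; have := envelope_like_lbound 0; lra.
pose K := [set x : 'rV[R]_n | `|x| <= M].
have Kc : compact K by exact: compact_mx_ball.
have K0 : K 0 by rewrite /K/= normr0.
have [|x Kx xmin] := lower_semicontinuous_compact_min Kc _ envelope_like_lsc.
  by exists 0.
exists x => y; have [Ky|] := pselect (K y).
  by have := xmin _ Ky; rewrite lee_fin.
rewrite /K/= => /negP; rewrite -ltNge ltr_pdivrMr//.
move=> yM; have := xmin _ K0; rewrite lee_fin => x0.
have := envelope_like_coercive F_env y; nra.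
Qed.

Lemma envelope_like_min_norm x :
  (forall y, F x <= F y) -> `|x| <= (F 0 + b) / a.
Proof.
move=> xmin; rewrite ler_pdivlMr//.
by have := envelope_like_coercive F_env x; have := xmin 0; nra.
Qed.

(* Semiconcavity upgrades the lower bound [F x <= F (x - t *: d)] to a quadratic
   upper bound on [F (x + d)], in the limit [t --> 0]. *)
Lemma envelope_like_min_majorant x y :
  (forall z, F x <= F z) -> F y <= F x + q * sqnorm (y - x).
Proof.
move=> xmin; apply/ler_addgt0Pr => e e0.
pose S := q * sqnorm (y - x).
have S0 : 0 <= S by rewrite mulr_ge0 ?sqnorm_ge0// ltW.
(* This choice gives [t * S <= e], so replacing [S] by [(1 + t) * S] costs at most [e]. *)
pose t := e / (S + 1).
have S10 : 0 < S + 1 by lra.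
have t0 : 0 < t by rewrite divr_gt0.
have tE : t * (S + 1) = e by rewrite mulfVK// gt_eqF.
have := envelope_like_semiconcave F_env x (y - x) (ltW t0).
rewrite subrKC; have := xmin (x - t *: (y - x)).
rewrite (mulrAC q) -/S => h1 h2.
have : t * F y <= t * (F x + (1 + t) * S) by nra.
rewrite ler_pM2l//; nra.
Qed.

End envelope_like.

(** * The double-envelope transform and its minimizers *)

Section proximal_hull.
Context {R : realType} {n : nat}.
Variables (mu a b : R).
Hypotheses (mu_gt0 : 0 < mu) (a_gt0 : 0 < a).
Implicit Types (x y z w d : 'rV[R]_n).
Let q := 1 / (2 * mu).

Lemma moreau_coef_gt0 : 0 < q.
Proof. by rewrite divr_gt0// mulr_gt0. Qed.

Lemma moreau_env_le (f : 'rV[R]_n -> \bar R) x w :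
  (moreau_env mu f x <= f w + (q * sqnorm (w - x))%:E)%E.
Proof. by rewrite -enorm_sqr; apply: ereal_inf_lbound; exists w. Qed.

Lemma moreau_env_ge (f : 'rV[R]_n -> \bar R) x (c : \bar R) :
  (forall w, c <= f w + (q * sqnorm (w - x))%:E)%E ->
  (c <= moreau_env mu f x)%E.
Proof.
move=> h; apply: le_ereal_inf_tmp => _ [w _ <-].
by rewrite enorm_sqr.
Qed.

Variable F : 'rV[R]_n -> R.
Hypothesis F_env : envelope_like q a b F.
(** For [F] the Moreau envelope of a function this is its proximal hull; for a convex combination of
    two envelopes it is the proximal average. *)
Let P x := (- moreau_env mu (fun y => (- F y)%:E) x)%E.

Lemma le_proximal_hull x : ((F x)%:E <= P x)%E.
Proof.
rewrite leeNr; apply: le_trans (moreau_env_le _ x x) _.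
by rewrite subrr sqnorm0 mulr0 adde0.
Qed.

Lemma proximal_hull_min x : (forall y, F x <= F y) -> P x = (F x)%:E.
Proof.
move=> xmin; apply/eqP; rewrite eq_le le_proximal_hull andbT leeNl.
apply: moreau_env_ge => w; rewrite -EFinN -EFinD lee_fin.
have := envelope_like_min_majorant moreau_coef_gt0 F_env w xmin; lra.
Qed.

Lemma einf_proximal_hull x : (forall y, F x <= F y) -> einf P = (F x)%:E.
Proof.
move=> xmin; apply/eqP; rewrite eq_le; apply/andP; split.
  by rewrite -(proximal_hull_min xmin); apply: ereal_inf_lbound; exists x.
apply: le_ereal_inf_tmp => _ [y _ <-].
by apply: le_trans (le_proximal_hull y); rewrite lee_fin.
Qed.

Lemma argmin_proximal_hull : argmin P = [set x | forall y, F x <= F y].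
Proof.
have [m mmin] := envelope_like_has_min moreau_coef_gt0 a_gt0 F_env.
apply/seteqP; split=> x /=; rewrite /argmin/= (einf_proximal_hull mmin).
  move=> Px y; apply: le_trans (mmin y).
  by rewrite -lee_fin -Px le_proximal_hull.
move=> xmin; rewrite (proximal_hull_min xmin).
by congr EFin; apply/eqP; rewrite eq_le xmin mmin.
Qed.

End proximal_hull.

(** * Linear minorants from level-coercivity *)

(** Far out, the positive lower limit gives slope [a] in the Euclidean norm, hence in the smaller
    maximum norm; on the remaining ball [f] is bounded below by semicontinuity. *)
Lemma level_coercive_minorant (R : realType) (n : nat)
    (f : 'rV[R]_n -> \bar R) :
  proper_efun f -> lower_semicontinuous f -> level_coercive f ->
  exists a b : R, 0 < a /\ forall x, ((a * `|x| - b)%:E <= f x)%E.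
Proof.
move=> [f_gtNy _] f_lsc; rewrite /level_coercive limf_einfE.
move=> /ereal_sup_gtP[_ [V [M _ MV] <-]] /real_between_ereal[a /andP[a0 aV]].
rewrite lte_fin in a0.
have far x : M < enorm x -> 0 < enorm x -> ((a * `|x|)%:E <= f x)%E.
  move=> Mx x0.
  have : (a%:E <= f x / (enorm x)%:E)%E.
    apply: (le_trans (ltW aV)); apply: ereal_inf_lbound.
    by exists x => //; exact: MV.
  rewrite inver gt_eqF// lee_pdivlMr// -EFinM; apply: le_trans.
  by rewrite lee_fin ler_pM2l// mx_norm_le_enorm.
(* The maximum with 0 makes [enorm y] positive outside the ball, as clearing the denominator in
   [far] requires. *)
pose M0 := Num.max 0 M.
have M00 : 0 <= M0 by rewrite le_max lexx.
pose K := [set x : 'rV[R]_n | `|x| <= M0].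
have Kc : compact K by exact: compact_mx_ball.
have K0 : K 0 by rewrite /K/= normr0.
have [|x Kx xmin] := lower_semicontinuous_compact_min Kc _ f_lsc.
  by exists 0.
have [c /andP[_ cf]] := real_between_ereal (f_gtNy x).
(* On the ball, [a * M0] pays for the linear term and [|c|] for a possibly negative lower bound of
   [f]. *)
exists a, (a * M0 + `|c|); split=> // y.
have [Ky|] := pselect (K y).
  apply: le_trans (xmin _ Ky); apply: le_trans (ltW cf); rewrite lee_fin.
  have : a * `|y| <= a * M0 by rewrite ler_pM2l.
  by have := ler_norm (- c); rewrite normrN; lra.
rewrite /K/= => /negP; rewrite -ltNge.
rewrite gt_max => /andP[y0 My].
have yy := mx_norm_le_enorm y.
apply: le_trans (far y (lt_le_trans My yy) (lt_le_trans y0 yy)).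
have : 0 <= a * M0 by rewrite mulr_ge0// ltW.
by rewrite lee_fin; have := normr_ge0 c; lra.
Qed.

(** * Moreau envelopes of linearly minorized functions *)

Section moreau_envelope.
Context {R : realType} {n : nat}.
Variables (mu a b : R) (f : 'rV[R]_n -> \bar R).
Hypotheses (mu_gt0 : 0 < mu) (a_gt0 : 0 < a) (f_proper : proper_efun f).
Hypothesis f_ge : forall x, ((a * `|x| - b)%:E <= f x)%E.
Implicit Types (x y z w d : 'rV[R]_n).
Let q := 1 / (2 * mu).
Let F x : R := fine (moreau_env mu f x).

Lemma moreau_env_fin_num x : moreau_env mu f x \is a fin_num.
Proof.
rewrite fin_numE -ltey -ltNye; apply/andP; split.
  apply: (@lt_le_trans _ _ (- b)%:E); first exact: ltNyr.
  apply: moreau_env_ge => w; rewrite -[leLHS]adde0; apply: leeD.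
    apply: le_trans (f_ge w); rewrite lee_fin lerDr mulr_ge0//.
    exact: ltW.
  by rewrite lee_fin mulr_ge0 ?sqnorm_ge0// ltW// moreau_coef_gt0.
case: f_proper => _ [w fw]; apply: le_lt_trans (moreau_env_le _ _ _ w) _.
by rewrite lte_add_pinfty// ltry.
Qed.

Lemma moreau_envE x : moreau_env mu f x = (F x)%:E.
Proof. by rewrite fineK// moreau_env_fin_num. Qed.

Lemma fine_moreau_env_le x w r : f w = r%:E -> F x <= r + q * sqnorm (w - x).
Proof.
by move=> fw; rewrite -lee_fin -moreau_envE EFinD -fw; exact: moreau_env_le.
Qed.

(** Points where [f] is [+oo] do not constrain the infimum and properness excludes [-oo], so only
    real values are tested. *)
Lemma fine_moreau_env_ge x c :
  (forall w r, f w = r%:E -> c <= r + q * sqnorm (w - x)) -> c <= F x.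
Proof.
move=> h; rewrite -lee_fin -moreau_envE; apply: moreau_env_ge => w.
case fw : (f w) => [r| |]; last by have := f_proper.1 w; rewrite fw.
  by rewrite -EFinD lee_fin h.
by rewrite leey.
Qed.

(** Each inequality is checked at one competitor [w] of the infimum. The constant added to [b] is
    minus the minimum of [q * p ^+ 2 - a * p] over [p]. *)
Lemma moreau_env_envelope_like : envelope_like q a (b + a ^+ 2 / (4 * q)) F.
Proof.
have q0 : 0 < q := moreau_coef_gt0 mu_gt0.
have fr w r : f w = r%:E -> a * `|w| - b <= r.
  by move=> fw; rewrite -lee_fin -fw.
split.
- move=> x; apply: fine_moreau_env_ge => w r fw.
  have := fr _ _ fw; have : `|x| <= `|w| + `|w - x|.
    rewrite -{1}(subKr w x); exact: ler_normB.
  move=> /(ler_wpM2l (ltW a_gt0)).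
  have := ler_wpM2l (ltW q0) (sqr_mx_norm_le (w - x)).
  set p := `|w - x|.
  (* Completing the square in [p]. *)
  have : 0 <= q * (p - a / (2 * q)) ^+ 2 by rewrite mulr_ge0 ?sqr_ge0 ?(ltW q0).
  rewrite (_ : q * (p - a / (2 * q)) ^+ 2 =
    q * p ^+ 2 - a * p + a ^+ 2 / (4 * q)); last by field; rewrite gt_eqF.
  by lra.
(* Young's inequality bounds [(1 - s) * F y] through the same [w]; the missing share [s * r] is at
   least [- s * b]. *)
- move=> s x y /andP[s0 s1]; apply: fine_moreau_env_ge => w r fw.
  have := fr _ _ fw; have := fine_moreau_env_le y fw.
  have := ler_wpM2l (ltW q0) (sqnorm_young w x y s0).
  have : 0 <= a ^+ 2 / (4 * q) by rewrite divr_ge0 ?sqr_ge0// mulr_ge0// ltW.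
  have : 0 <= a * `|w| by rewrite mulr_ge0// ltW.
  rewrite -mulrA; set e := a ^+ 2 / _; set u := a * `|w|.
  set S1 := sqnorm _; set S2 := sqnorm _; set S3 := _ * sqnorm _.
  rewrite mulrDr; set T3 := q * S3 => u0 e0 hS hF hr.
  have : (1 - s) * F y <= (1 - s) * (r + q * S1).
    by rewrite ler_wpM2l// subr_ge0.
  have : 0 <= s * (u + e) by rewrite mulr_ge0 ?addr_ge0// ltW.
  have : s * (u - b) <= s * r by rewrite ler_pM2l.
  by lra.
(* A single [w] competes at both [x + d] and [x - t *: d]; [sqnorm_stewart] evaluates the weighted
   sum of penalties exactly. *)
- move=> x d t t0; have t1 : 0 < 1 + t by lra.
  rewrite [leRHS]mulrC -ler_pdivrMr// -lerBlDr.
  apply: fine_moreau_env_ge => w r fw.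
  rewrite lerBlDr ler_pdivrMr//.
  have h1 := ler_wpM2l t0 (fine_moreau_env_le (x + d) fw).
  have h2 := fine_moreau_env_le (x - t *: d) fw.
  apply: le_trans (lerD h1 h2) _.
  rewrite [leRHS](_ : _ =
    (1 + t) * r + q * ((1 + t) * (sqnorm (w - x) + t * sqnorm d)));
    last by ring.
  by rewrite -sqnorm_stewart -subr_ge0 [leRHS](_ : _ = 0)//; ring.
Qed.

Lemma einf_moreau_env x : (forall y, F x <= F y) -> einf f = (F x)%:E.
Proof.
move=> xmin; apply/eqP; rewrite eq_le; apply/andP; split.
  rewrite -moreau_envE; apply: moreau_env_ge => w.
  rewrite -[leLHS]adde0; apply: leeD.
    by apply: ereal_inf_lbound; exists w.
  by rewrite lee_fin mulr_ge0 ?sqnorm_ge0// ltW// moreau_coef_gt0.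
apply: le_ereal_inf_tmp => _ [w _ <-].
apply: (@le_trans _ _ (F w)%:E); first by rewrite lee_fin.
rewrite -moreau_envE; apply: le_trans (moreau_env_le _ _ _ w) _.
by rewrite subrr sqnorm0 mulr0 adde0.
Qed.

(** If [F x < c < f x], then near [x] competitors cost more than [c] by semicontinuity, while
    outside a ball of radius [r] the penalty adds at least [q * r ^+ 2] to the infimum; so [F x]
    would exceed itself. *)
Lemma argmin_moreau_env :
  lower_semicontinuous f -> [set x | forall y, F x <= F y] `<=` argmin f.
Proof.
move=> f_lsc x /= xmin; have fx := einf_moreau_env xmin.
rewrite /argmin/=; apply/eqP; rewrite eq_le; apply/andP; split; last first.
  by apply: ereal_inf_lbound; exists x.
rewrite leNgt; apply/negP; rewrite fx => /real_between_ereal[c /andP[Fc cf]].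
have [V /nbhs_ballP[r /= r0 rV] Vc] := f_lsc _ _ cf.
rewrite lte_fin in Fc.
have q0 : 0 < q := moreau_coef_gt0 mu_gt0.
suff : Num.min c (F x + q * r ^+ 2) <= F x.
  rewrite leNgt lt_min Fc/= ltrDl mulr_gt0// exprn_gt0//.
apply: fine_moreau_env_ge => w s fw; rewrite ge_min.
have qS : 0 <= q * sqnorm (w - x) by rewrite mulr_ge0 ?sqnorm_ge0// ltW.
have [/rV/Vc|] := pselect (ball x r w).
  by rewrite fw lte_fin => cs; apply/orP; left; lra.
rewrite -ball_normE/= => /negP; rewrite -leNgt distrC => rw; apply/orP; right.
apply: lerD.
  by rewrite -lee_fin -fx -fw; apply: ereal_inf_lbound; exists w.
rewrite ler_pM2l//; apply: le_trans (sqr_mx_norm_le _).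
by rewrite lerXn2r ?nnegrE// ltW.
Qed.

End moreau_envelope.

(** * Stability in [alpha] of convex combinations of two envelopes *)

Section interpolation.
Context {R : realType} {n : nat}.
Variables (q a b : R) (F G : 'rV[R]_n -> R).
Hypotheses (q_gt0 : 0 < q) (a_gt0 : 0 < a).
Hypotheses (F_env : envelope_like q a b F) (G_env : envelope_like q a b G).
Implicit Types (x y : 'rV[R]_n) (alpha beta : R).
Let psi alpha x := alpha * F x + (1 - alpha) * G x.
Let minimizers alpha := [set x | forall y, psi alpha x <= psi alpha y].

(** [psi alpha 0 <= top] and coercivity confine all minimizers to the ball of this [radius]. There
    [gap] bounds [|F - G|], by [envelope_like_ubound] and the lower bound [- b]; the factor [n]
    converts the maximum norm. *)
Let top := Num.max (F 0) (G 0).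
Let radius := (top + b) / a.
Let gap := 2 * top + 2 * (q * (n%:R * radius ^+ 2)) + 2 * b.

Let psi_env alpha : alpha \in `[0, 1] -> envelope_like q a b (psi alpha).
Proof. by rewrite in_itv/= => al; apply: envelope_like_conv. Qed.

Lemma interpolation_min_norm alpha x :
  alpha \in `[0, 1] -> minimizers alpha x -> `|x| <= radius.
Proof.
move=> al /(envelope_like_min_norm a_gt0 (psi_env al)) /le_trans; apply.
rewrite ler_pM2r ?invr_gt0// lerD2r /psi.
have FM : F 0 <= top by rewrite le_max lexx.
have GM : G 0 <= top by rewrite le_max lexx orbT.
move: al; rewrite in_itv/= => /andP[al0 al1].
by rewrite (_ : top = alpha * top + (1 - alpha) * top);
  [rewrite lerD// ler_wpM2l ?subr_ge0|ring].
Qed.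

Lemma interpolation_gap x : `|x| <= radius -> `|F x - G x| <= gap.
Proof.
move=> xr; have xS : q * sqnorm x <= q * (n%:R * radius ^+ 2).
  rewrite ler_pM2l//; apply: le_trans (sqnorm_le x) _.
  by rewrite ler_wpM2l// lerXn2r ?nnegrE// (le_trans _ xr).
have FM : F 0 <= top by rewrite le_max lexx.
have GM : G 0 <= top by rewrite le_max lexx orbT.
have := envelope_like_ubound a_gt0 F_env x.
have := envelope_like_ubound a_gt0 G_env x.
have := envelope_like_lbound a_gt0 F_env x.
have := envelope_like_lbound a_gt0 G_env x.
rewrite ler_norml /gap => *; apply/andP; split; lra.
Qed.

Lemma interpolation_dist alpha beta x : `|x| <= radius ->
  psi alpha x <= psi beta x + `|alpha - beta| * gap.
Proof.
move=> /interpolation_gap xg; rewrite -lerBlDl.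
rewrite (_ : _ - _ = (alpha - beta) * (F x - G x)); last by rewrite /psi; ring.
by apply: le_trans (ler_norm _) _; rewrite normrM ler_wpM2l.
Qed.

(** Each minimizer serves as a competitor for the other parameter. *)
Lemma interpolation_min_dist alpha beta x y :
  alpha \in `[0, 1] -> beta \in `[0, 1] ->
  minimizers alpha x -> minimizers beta y ->
  `|psi alpha x - psi beta y| <= `|alpha - beta| * gap.
Proof.
move=> al be xmin ymin.
have hx := interpolation_dist beta alpha (interpolation_min_norm al xmin).
have hy := interpolation_dist alpha beta (interpolation_min_norm be ymin).
rewrite distrC in hx; have := xmin y; have := ymin x.
by rewrite ler_norml => *; apply/andP; split; lra.
Qed.

Lemma interpolation_gap_ge0 alpha x :
  alpha \in `[0, 1] -> minimizers alpha x -> 0 <= gap.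
Proof.
by move=> al /(interpolation_min_norm al)/interpolation_gap; exact: le_trans.
Qed.

Lemma interpolation_has_min alpha :
  alpha \in `[0, 1] -> exists x, minimizers alpha x.
Proof. by move=> /psi_env; exact: envelope_like_has_min. Qed.

Lemma outer_limit_minimizers abar : abar \in `[0, 1] ->
  outer_limit `[0, 1] abar minimizers `<=` minimizers abar.
Proof.
move=> ab x [alpha [N [u [al01 alc Ni umin uc]]]].
have [m mmin] := interpolation_has_min ab.
have g0 := interpolation_gap_ge0 ab mmin.
have psi_lsc := envelope_like_lsc q_gt0 a_gt0 (psi_env ab).
suff xm : psi abar x <= psi abar m by move=> y; exact: le_trans xm (mmin y).
rewrite leNgt; apply/negP => mx.
pose c := (psi abar m + psi abar x) / 2.
have [V Vx Vc] :
    exists2 V, nbhs x V & forall y, V y -> (c%:E < (psi abar y)%:E)%E.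
  by apply: psi_lsc; rewrite /= lte_fin /c; lra.
(* An increasing [N] satisfies [k <= N k], hence tends to infinity. *)
have alNc : (alpha \o N) @ \oo --> abar.
  apply: cvg_comp alc; apply/cvgnyPge => A; exists A => // k /= Ak.
  apply: leq_trans Ak _; elim: k => // k /leq_ltn_trans; apply.
  exact: (iffRL (increasing_seqP N) Ni).
(* Passing from [abar] to [alpha (N k)] at [u k] and back at [m] costs [2 * gap] times their
   distance; the added 1 keeps the denominator positive. *)
pose e := (c - psi abar m) / (2 * gap + 1).
have e0 : 0 < e by rewrite divr_gt0//; [rewrite /c; lra|lra].
have [k [Vk ke]] : exists k, V (u k) /\ `|alpha (N k) - abar| < e.
  have /cvgrPdist_lt/(_ e e0) alNe := alNc.
  have : \forall k \near \oo, V (u k) /\ `|alpha (N k) - abar| < e.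
    by near=> k; split; near: k; [exact: uc|under eq_near do rewrite distrC].
  by move=> /filter_ex.
have uk : `|u k| <= radius.
  by apply: interpolation_min_norm (umin k); exact: al01.
have h1 := interpolation_dist abar (alpha (N k)) uk.
have h2 := umin k m.
have h3 := interpolation_dist (alpha (N k)) abar
  (interpolation_min_norm ab mmin).
have := Vc _ Vk; rewrite lte_fin => ck.
rewrite distrC in h1.
move: ke; rewrite ltr_pdivlMr; last by lra.
have := normr_ge0 (alpha (N k) - abar); lra.
Unshelve. all: end_near. Qed.

End interpolation.

(** * Assembly: limits, boundedness and the two end points *)

Lemma proximal_avgE (R : realType) (n : nat) (mu : R) (f g : 'rV[R]_n -> \bar R)
    (F G : 'rV[R]_n -> R) (alpha : R) :
  (forall x, moreau_env mu f x = (F x)%:E) ->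
  (forall x, moreau_env mu g x = (G x)%:E) ->
  proximal_avg mu f g alpha = fun x =>
    (- moreau_env mu (fun y => (- (alpha * F y + (1 - alpha) * G y))%:E) x)%E.
Proof.
move=> fF gG; apply/funext => x; congr (- moreau_env mu _ x)%E.
apply/funext => y; rewrite fF gG -EFinN -!EFinM -EFinB.
by rewrite mulNr opprD.
Qed.

Theorem theorem7p11 (R : realType) (n : nat) (f g : 'rV[R]_n -> \bar R)
    (mu : R)
    (f_proper : proper_efun f) (g_proper : proper_efun g)
    (f_lsc : lower_semicontinuous f) (g_lsc : lower_semicontinuous g)
    (f_lc : level_coercive f) (g_lc : level_coercive g)
    (mu_gt0 : 0 < mu) :
  let phi := proximal_avg mu f g in
  [/\ forall abar : R, abar \in `[0, 1] ->
        [/\ einf (phi alpha) @[alpha --> within `[0, 1] (nbhs abar)]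
              --> einf (phi abar),
            einf (phi abar) \is a fin_num &
            outer_limit `[0, 1] abar (fun alpha => argmin (phi alpha))
              `<=` argmin (phi abar)],
      exists M : R, forall alpha : R, alpha \in `[0, 1] ->
        argmin (phi alpha) `<=` [set x | enorm x <= M],
      einf (phi alpha) @[alpha --> 0^'+] --> einf g /\
      outer_limit `]0, 1] 0 (fun alpha => argmin (phi alpha)) `<=` argmin g &
      einf (phi alpha) @[alpha --> 1^'-] --> einf f /\
      outer_limit `[0, 1[ 1 (fun alpha => argmin (phi alpha)) `<=` argmin f].
Proof.
move=> phi.
have [a1 [b1 [a10 fm]]] := level_coercive_minorant f_proper f_lsc f_lc.
have [a2 [b2 [a20 gm]]] := level_coercive_minorant g_proper g_lsc g_lc.
(* Common constants let both envelopes share one triple [q], [a], [b], as convex combinations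
   require. *)
pose a := Num.min a1 a2; pose b := Num.max b1 b2.
have a0 : 0 < a by rewrite lt_min a10.
have minorant (c d : R) (x : 'rV[R]_n) :
    a <= c -> d <= b -> a * `|x| - b <= c * `|x| - d.
  by move=> ac db; apply: lerB => //; apply: ler_wpM2r.
have f_ge x : ((a * `|x| - b)%:E <= f x)%E.
  apply: le_trans (fm x); rewrite lee_fin minorant//.
    by rewrite ge_min lexx.
  by rewrite le_max lexx.
have g_ge x : ((a * `|x| - b)%:E <= g x)%E.
  apply: le_trans (gm x); rewrite lee_fin minorant//.
    by rewrite ge_min lexx orbT.
  by rewrite le_max lexx orbT.
pose q := 1 / (2 * mu).
have q0 : 0 < q := moreau_coef_gt0 mu_gt0.
pose F x := fine (moreau_env mu f x); pose G x := fine (moreau_env mu g x).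
have FE := moreau_envE mu_gt0 a0 f_proper f_ge.
have GE := moreau_envE mu_gt0 a0 g_proper g_ge.
have F_env := moreau_env_envelope_like mu_gt0 a0 f_proper f_ge.
have G_env := moreau_env_envelope_like mu_gt0 a0 g_proper g_ge.
rewrite -/q -/F in F_env FE; rewrite -/q -/G in G_env GE.
pose psi alpha x := alpha * F x + (1 - alpha) * G x.
pose minimizers alpha := [set x | forall y, psi alpha x <= psi alpha y].
have psi_env (alpha : R) : alpha \in `[0, 1] ->
    envelope_like q a (b + a ^+ 2 / (4 * q)) (psi alpha).
  by rewrite in_itv/= => al; apply: envelope_like_conv.
have phiE alpha := proximal_avgE alpha FE GE.
have argminE (alpha : R) : alpha \in `[0, 1] ->
    argmin (phi alpha) = minimizers alpha.
  move=> al.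
  by rewrite /phi phiE (argmin_proximal_hull mu_gt0 a0 (psi_env _ al)).
have einfE (alpha : R) x : alpha \in `[0, 1] -> minimizers alpha x ->
    einf (phi alpha) = (psi alpha x)%:E.
  move=> al xm.
  by rewrite /phi phiE (einf_proximal_hull mu_gt0 (psi_env _ al) xm).
have has_min := interpolation_has_min q0 a0 F_env G_env.
have outer (D : set R) (abar : R) :
    D `<=` `[0, 1]%classic -> abar \in `[0, 1] ->
    outer_limit D abar (fun alpha => argmin (phi alpha)) `<=` minimizers abar.
  move=> D01 ab x [alpha [N [u [alD alc Ni Su uc]]]].
  apply: (outer_limit_minimizers q0 a0 F_env G_env ab).
  exists alpha, N, u; split=> // k; first exact/D01/alD.
  by rewrite -[X in X (u k)]argminE//; exact/D01/alD.
have einf_cvg (abar : R) : abar \in `[0, 1] ->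
    einf (phi alpha) @[alpha --> within `[0, 1] (nbhs abar)]
      --> einf (phi abar).
  move=> ab; have [m mmin] := has_min _ ab.
  rewrite (einfE _ _ ab mmin); apply: cvg_EFin.
    rewrite near_withinE; near=> alpha => al; have [x xmin] := has_min _ al.
    by rewrite (einfE _ _ al xmin).
  apply/cvgrPdist_lt => e e0.
  have g0 := interpolation_gap_ge0 q0 a0 F_env G_env ab mmin.
  (* The Lipschitz constant, local to its section, is recovered from its nonnegativity statement. *)
  set gap := (X in 0 <= X) in g0.
  have r0 : 0 < e / (gap + 1) by rewrite divr_gt0// ltr_wpDl.
  rewrite near_withinE; near=> alpha => al /=; have [x xmin] := has_min _ al.
  rewrite (einfE _ _ al xmin)/=.
  have ae : `|abar - alpha| < e / (gap + 1).
    have : ball abar (e / (gap + 1)) alpha by near: alpha; exact: nbhsx_ballx.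
    by rewrite -ball_normE.
  have := interpolation_min_dist q0 a0 F_env G_env ab al mmin xmin.
  move=> /le_lt_trans; apply.
  rewrite -/gap; move: ae; rewrite ltr_pdivlMr ?ltr_wpDl//.
  by apply: le_lt_trans; rewrite ler_wpM2l// lerDl.
have zero01 : (0 : R) \in `[0, 1] by rewrite in_itv/= lexx ler01.
have one01 : (1 : R) \in `[0, 1] by rewrite in_itv/= lexx ler01.
have min0 : minimizers 0 = [set x | forall y, G x <= G y].
  by apply/seteqP; split=> x /= h y; have := h y; rewrite /psi; lra.
have min1 : minimizers 1 = [set x | forall y, F x <= F y].
  by apply/seteqP; split=> x /= h y; have := h y; rewrite /psi; lra.
split.
- move=> abar ab; split; [exact: einf_cvg| |].
    by have [m mmin] := has_min _ ab; rewrite (einfE _ _ ab mmin).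
  by rewrite [X in _ `<=` X]argminE//; exact: outer.
(* This is [radius] with [b] replaced by the envelope constant. *)
- pose r := (Num.max (F 0) (G 0) + (b + a ^+ 2 / (4 * q))) / a.
  exists (Num.sqrt (n%:R * r ^+ 2)).
  move=> alpha al; rewrite argminE// => x xmin /=.
  apply: le_trans (enorm_le x) _.
  rewrite ler_sqrt; last by rewrite mulr_ge0// sqr_ge0.
  have xr := interpolation_min_norm a0 F_env G_env al xmin.
  by rewrite ler_wpM2l// lerXn2r ?nnegrE// (le_trans _ xr).
- split.
    have [m mmin] := has_min _ zero01.
    rewrite (einf_moreau_env mu_gt0 a0 g_proper g_ge (x := m)); last first.
      by move: mmin; rewrite -/(minimizers 0 m) min0.
    rewrite (_ : fine _ = psi 0 m);
      last by rewrite /psi mul0r add0r subr0 mul1r.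
    rewrite -(einfE _ _ zero01 mmin); apply: cvg_trans (einf_cvg _ zero01).
    apply: cvg_app => A A01.
    have {}A01 : \forall alpha \near (0 : R), alpha \in `[0, 1] -> A alpha.
      exact: A01.
    suff : \forall alpha \near (0 : R), 0 < alpha -> A alpha by [].
    near=> alpha => al0.
    have al1 : alpha < 1 by near: alpha; exact: lt_nbhsl.
    by apply: (near A01 alpha) => //=; rewrite in_itv/= !ltW.
  apply: subset_trans (outer _ _ _ zero01) _.
    by move=> alpha /=; rewrite !in_itv/= => /andP[/ltW-> ->].
  by rewrite min0; apply: (argmin_moreau_env mu_gt0 a0 g_proper g_ge).
- split.
    have [m mmin] := has_min _ one01.
    rewrite (einf_moreau_env mu_gt0 a0 f_proper f_ge (x := m)); last first.
      by move: mmin; rewrite -/(minimizers 1 m) min1.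
    rewrite (_ : fine _ = psi 1 m);
      last by rewrite /psi subrr mul0r addr0 mul1r.
    rewrite -(einfE _ _ one01 mmin); apply: cvg_trans (einf_cvg _ one01).
    apply: cvg_app => A A01.
    have {}A01 : \forall alpha \near (1 : R), alpha \in `[0, 1] -> A alpha.
      exact: A01.
    suff : \forall alpha \near (1 : R), alpha < 1 -> A alpha by [].
    near=> alpha => al1.
    have al0 : 0 < alpha by near: alpha; exact: lt_nbhsr.
    by apply: (near A01 alpha) => //=; rewrite in_itv/= !ltW.
  apply: subset_trans (outer _ _ _ one01) _.
    by move=> alpha /=; rewrite !in_itv/= => /andP[-> /ltW->].
  by rewrite min1; apply: (argmin_moreau_env mu_gt0 a0 f_proper f_ge).
Unshelve. all: end_near. Qed.
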